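(* Let $(D,V,H,\gamma,\phi)$ be a collection consisting of a group $D$, subgroups $V,H\subseteq D$, a map $\gamma:\mathcal P\to D$, $P\mapsto\gamma_P$, from a set $\mathcal P$ with a base point $O\in\mathcal P$, $\gamma_O=1$, such that $D=\coprod_{P\in\mathcal P}V\gamma_PH$ and $V\cap zHz^{-1}=\{1\}$ for all $z\in D$, and a group isomorphism $\phi:H\to V$. Then $(D,V,H,\gamma,\phi)$ is a braided groupoid datum if and only if $$g=\lambda_V(P,g,Q)\,\phi(\rho_V(P,g,Q)),$$ $$\phi(x)=\lambda_H(P,x,Q)\,\phi(\rho_H(P,x,Q)),$$ $$\phi(x)g=(x\triangleright g)\,\phi(x\triangleleft g)$$ for all $P,Q\in\mathcal P$, $g\in V$, $x\in H$.
   Context: Groupoids: $\mathfrak s,\mathfrak e$ denote source and target; $g,h$ are composable if $\mathfrak e(g)=\mathfrak s(h)$, and the composite is written $gh$. $\mathcal G(P,Q)$ is the set of arrows with source $P$ and target $Q$, and $\mathcal G(P)=\mathcal G(P,P)$. A subgroupoid is wide if it has the same set of objects. A left action of a groupoid $\mathcal G\rightrightarrows\mathcal P$ on $(\mathcal E,p:\mathcal E\to\mathcal P)$ is a map $(g,x)\mapsto g\rightharpoonup x$ defined when $\mathfrak e(g)=p(x)$ with $p(g\rightharpoonup x)=\mathfrak s(g)$, $g\rightharpoonup(h\rightharpoonup x)=gh\rightharpoonup x$, $\mathrm{id}_{p(x)}\rightharpoonup x=x$. A right action is a map $(x,g)\mapsto x\leftharpoonup g$ defined when $p(x)=\mathfrak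 s(g)$ with $p(x\leftharpoonup g)=\mathfrak e(g)$, $(x\leftharpoonup g)\leftharpoonup h=x\leftharpoonup gh$, $x\leftharpoonup\mathrm{id}_{p(x)}=x$. A matched pair of groupoids $(\mathcal V,\mathcal H,\rightharpoonup,\leftharpoonup)$ consists of groupoids $\mathcal V,\mathcal H$ over the same base, a left action $\rightharpoonup$ of $\mathcal H$ on $(\mathcal V,\mathfrak s)$ and a right action $\leftharpoonup$ of $\mathcal V$ on $(\mathcal H,\mathfrak e)$ (so both are defined on pairs $(x,g)\in\mathcal H\times\mathcal V$ with $\mathfrak e(x)=\mathfrak s(g)$) such that $\mathfrak e(x\rightharpoonup g)=\mathfrak s(x\leftharpoonup g)$, $x\rightharpoonup gh=(x\rightharpoonup g)((x\leftharpoonup g)\rightharpoonup h)$, $xy\leftharpoonup g=(x\leftharpoonup(y\rightharpoonup g))(y\leftharpoonup g)$ whenever defined. A braided groupoid $(\mathcal V,\rightharpoonup,\leftharpoonup)$ is a groupoid $\mathcal V$ such that $(\mathcal V,\mathcal V,\rightharpoonup,\leftharpoonup)$ is a matched pair and $fg=(f\rightharpoonup g)(f\leftharpoonup g)$ for all composable $f,g$. From $(D,V,H,\gamma,\phi)$ to groupoids: every $z\in D$ can be written uniquely as $z=g\gamma_Px$ with $g\in V$, $P\in\mathcal P$, $x\in H$. Let $\mathcal D\rightrightarrows\mathcal P$ be a connected groupoid with $\mathcal D(O)=D$ and choose $\tau_P\in\mathcal D(O,P)$ for each $P$, $\tau_O=1$. Define wide subgroupoids $\mathcal V(P,Q)=\tau_P^{-1}V\tau_Q$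 and $\mathcal H(P,Q)=\tau_P^{-1}\gamma_PH\gamma_Q^{-1}\tau_Q$. Every arrow of $\mathcal D$ is uniquely a product of an arrow of $\mathcal V$ followed by an arrow of $\mathcal H$; for composable $x\in\mathcal H$, $g\in\mathcal V$ write $xg=(x\rightharpoonup g)(x\leftharpoonup g)$ with $x\rightharpoonup g\in\mathcal V$, $x\leftharpoonup g\in\mathcal H$; this makes $(\mathcal V,\mathcal H,\rightharpoonup,\leftharpoonup)$ a matched pair. The isomorphism $\phi:H\to V$ induces a groupoid isomorphism $\phi:\mathcal H\to\mathcal V$, $\phi(\tau_P^{-1}\gamma_Px\gamma_Q^{-1}\tau_Q)=\tau_P^{-1}\phi(x)\tau_Q$. Transport: for composable $g,h\in\mathcal V$ put $g\rightharpoonup h:=\phi^{-1}(g)\rightharpoonup h$ and $g\leftharpoonup h:=\phi(\phi^{-1}(g)\leftharpoonup h)$; then $(\mathcal V,\mathcal V,\rightharpoonup,\leftharpoonup)$ is a matched pair. The collection $(D,V,H,\gamma,\phi)$ is called a braided groupoid datum if $(\mathcal V,\rightharpoonup,\leftharpoonup)$ is a braided groupoid. Equivalently, the map $m:\mathcal D\to\mathcal V$, $m(\beta_1\beta_2)=\beta_1\phi(\beta_2)$ for $\beta_1\in\mathcal V,\beta_2\in\mathcal H$, is a groupoid morphism (functor). The maps in the statement are defined by the unique decompositions in $D$, for $x\in H$, $g\in V$, $P,Q\in\mathcal P$: $xg=(x\triangleright g)\,\gamma_{(x;g)}\,(x\triangleleft g)$ with $x\triangleright g\in V$, $(x;g)\in\mathcal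 P$, $x\triangleleft g\in H$; $\gamma_Pg\gamma_Q=\lambda_V(P,g,Q)\,\gamma_{(P;g;Q)}\,\rho_V(P,g,Q)$ with $\lambda_V(P,g,Q)\in V$, $(P;g;Q)\in\mathcal P$, $\rho_V(P,g,Q)\in H$; $\gamma_Px\gamma_Q=\lambda_H(P,x,Q)\,\gamma_{\langle P;x;Q\rangle}\,\rho_H(P,x,Q)$ with $\lambda_H(P,x,Q)\in V$, $\langle P;x;Q\rangle\in\mathcal P$, $\rho_H(P,x,Q)\in H$. *)

(* Defs.v *)
From mathcomp Require Import all_boot.
From mathcomp Require Import boolp classical_sets functions.

Local Open Scope classical_set_scope.
Local Open Scope group_scope.

(* Composition is defined only on composable pairs, so it takes the *)
(* composability proof as an argument.  [gcomp g h e] is written [gh] in the *)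
(* usual left-to-right notation: first [g], then [h]. *)
Record groupoid (P : Type) := Groupoid {
  arr :> Type;
  src : arr -> P;
  tgt : arr -> P;
  gcomp : forall g h : arr, tgt g = src h -> arr;
  idt : P -> arr;
  ginv : arr -> arr;
  src_comp : forall g h e, src (gcomp g h e) = src g;
  tgt_comp : forall g h e, tgt (gcomp g h e) = tgt h;
  src_idt : forall p, src (idt p) = p;
  tgt_idt : forall p, tgt (idt p) = p;
  src_inv : forall g, src (ginv g) = tgt g;
  tgt_inv : forall g, tgt (ginv g) = src g;
  compA : forall g h k e1 e2 e3 e4,
    gcomp (gcomp g h e1) k e2 = gcomp g (gcomp h k e3) e4;
  comp_idl : forall g e, gcomp (idt (src g)) g e = g;
  comp_idr : forall g e, gcomp g (idt (tgt g)) e = g;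
  comp_invl : forall g e, gcomp (ginv g) g e = idt (tgt g);
  comp_invr : forall g e, gcomp g (ginv g) e = idt (src g)
}.

Arguments src {P g} _ : rename.
Arguments tgt {P g} _ : rename.
Arguments gcomp {P g} _ _ _ : rename.
Arguments idt {P} g _ : rename.
Arguments ginv {P g} _ : rename.

Set Implicit Arguments.
Unset Strict Implicit.
Unset Printing Implicit Defensive.

Definition connected P (G : groupoid P) : Prop :=
  forall p q : P, exists a : G, src a = p /\ tgt a = q.

Section Actions.
Variables (P : Type) (G : groupoid P) (E : Type) (p : E -> P).

Definition left_action (act : forall (g : G) (x : E), tgt g = p x -> E) : Prop :=
  [/\ forall g x e, p (act g x e) = src g,
      forall (g h : G) x (egh : tgt g = src h) ehx e1 e2,
        act g (act h x ehx) e1 = act (gcomp g h egh) x e2 &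
      forall x e, act (idt G (p x)) x e = x].

Definition right_action (act : forall (x : E) (g : G), p x = src g -> E) : Prop :=
  [/\ forall x g e, p (act x g e) = tgt g,
      forall x (g h : G) exg (egh : tgt g = src h) e1 e2,
        act (act x g exg) h e1 = act x (gcomp g h egh) e2 &
      forall x e, act x (idt G (p x)) e = x].

End Actions.

(* [la x g _] is $x \rightharpoonup g$ and [ra x g _] is $x \leftharpoonup g$. *)
Definition matched_pair P (V H : groupoid P)
    (la : forall (x : H) (g : V), tgt x = src g -> V)
    (ra : forall (x : H) (g : V), tgt x = src g -> H) : Prop :=
  left_action (p := src) la /\ right_action (p := tgt) ra /\
  [/\ forall x g e, tgt (la x g e) = src (ra x g e),
      forall x (g h : V) (e : tgt x = src g) (egh : tgt g = src h) e1 e2 e3,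
        la x (gcomp g h egh) e1 = gcomp (la x g e) (la (ra x g e) h e2) e3 &
      forall (x y : H) g (exy : tgt x = src y) (e : tgt y = src g) e1 e2 e3,
        ra (gcomp x y exy) g e1 = gcomp (ra x (la y g e) e2) (ra y g e) e3].

Definition braided_groupoid P (V : groupoid P)
    (la ra : forall f g : V, tgt f = src g -> V) : Prop :=
  matched_pair la ra /\
  forall f g e e', gcomp f g e = gcomp (la f g e) (ra f g e) e'.

Section Subgroupoid.
Variables (P : Type) (G : groupoid P).

Lemma comp_irr (g h : G) e e' : gcomp g h e = gcomp g h e'.
Proof. by congr (gcomp _ _ _); exact: Prop_irrelevance. Qed.

(* Total extension of the composition, used only in proofs: it can be *)
(* rewritten without transporting composability proofs. *)
Definition tcomp (g h : G) : G :=
  if pselect (tgt g = src h) is left e then gcomp g h e else g.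

Lemma tcompE g h e : gcomp g h e = tcomp g h.
Proof. by rewrite /tcomp; case: pselect => // e'; exact: comp_irr. Qed.

Lemma src_tcomp g h : src (tcomp g h) = src g.
Proof. by rewrite /tcomp; case: pselect => // e; rewrite src_comp. Qed.

Lemma tgt_tcomp g h : tgt g = src h -> tgt (tcomp g h) = tgt h.
Proof. by move=> e; rewrite -(tcompE e) tgt_comp. Qed.

Lemma tcompA g h k : tgt g = src h -> tgt h = src k ->
  tcomp (tcomp g h) k = tcomp g (tcomp h k).
Proof.
move=> e1 e3; rewrite -(tcompE e1) -(tcompE e3).
have e2 : tgt (gcomp g h e1) = src k by rewrite tgt_comp.
have e4 : tgt g = src (gcomp h k e3) by rewrite src_comp.
by rewrite -(tcompE e2) -(tcompE e4); exact: compA.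
Qed.

Lemma tcomp_idl g p : p = src g -> tcomp (idt G p) g = g.
Proof.
move=> ->; have e : tgt (idt G (src g)) = src g by rewrite tgt_idt.
by rewrite -(tcompE e) comp_idl.
Qed.

Lemma tcomp_idr g p : p = tgt g -> tcomp g (idt G p) = g.
Proof.
move=> ->; have e : tgt g = src (idt G (tgt g)) by rewrite src_idt.
by rewrite -(tcompE e) comp_idr.
Qed.

Lemma tcomp_invl g : tcomp (ginv g) g = idt G (tgt g).
Proof.
have e : tgt (ginv g) = src g by rewrite tgt_inv.
by rewrite -(tcompE e) comp_invl.
Qed.

Lemma tcomp_invr g : tcomp g (ginv g) = idt G (src g).
Proof.
have e : tgt g = src (ginv g) by rewrite src_inv.
by rewrite -(tcompE e) comp_invr.
Qed.

Lemma tcompK g h : tgt g = src h -> tcomp (ginv g) (tcomp g h) = h.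
Proof.
by move=> e; rewrite -tcompA ?tgt_inv // tcomp_invl tcomp_idl.
Qed.

Lemma tcompKV g h : src g = src h -> tcomp g (tcomp (ginv g) h) = h.
Proof.
by move=> e; rewrite -tcompA ?tgt_inv ?src_inv // tcomp_invr tcomp_idl.
Qed.

Lemma inv_uniq (g h : G) : tgt g = src h -> tcomp g h = idt G (src g) -> h = ginv g.
Proof.
by move=> e gh1; rewrite -(tcompK e) gh1 tcomp_idr // tgt_inv.
Qed.

(* Wideness is the first condition. *)
Definition wide_subgroupoid (S : set G) : Prop :=
  [/\ forall p, S (idt G p),
      forall g h e, S g -> S h -> S (gcomp g h e) &
      forall g, S g -> S (ginv g)].

Variables (S : set G) (hS : wide_subgroupoid S).

Lemma sub_id p : S (idt G p). Proof. by case: hS. Qed.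
Lemma sub_comp g h e : S g -> S h -> S (gcomp g h e).
Proof. by case: hS => _ + _; apply. Qed.
Lemma sub_inv g : S g -> S (ginv g).
Proof. by case: hS => _ _; apply. Qed.

Lemma sub_eq (a b : {a | S a}) : sval a = sval b -> a = b.
Proof. by case: a b => [a aS] [b bS] /= ab; subst; congr exist; exact: Prop_irrelevance. Qed.

Definition subgroupoid : groupoid P.
Proof.
refine (@Groupoid P {a : G | S a} (fun a => src (sval a)) (fun a => tgt (sval a))
  (fun g h e => exist _ (gcomp (sval g) (sval h) e)
                  (sub_comp e (proj2_sig g) (proj2_sig h)))
  (fun p => exist _ (idt G p) (sub_id p))
  (fun g => exist _ (ginv (sval g)) (sub_inv (proj2_sig g)))
  _ _ _ _ _ _ _ _ _ _ _) => /=.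
- by move=> *; rewrite src_comp.
- by move=> *; rewrite tgt_comp.
- by move=> *; rewrite src_idt.
- by move=> *; rewrite tgt_idt.
- by move=> *; rewrite src_inv.
- by move=> *; rewrite tgt_inv.
- by move=> *; apply: sub_eq => /=; exact: compA.
- by move=> *; apply: sub_eq => /=; exact: comp_idl.
- by move=> *; apply: sub_eq => /=; exact: comp_idr.
- by move=> *; apply: sub_eq => /=; exact: comp_invl.
- by move=> *; apply: sub_eq => /=; exact: comp_invr.
Defined.

End Subgroupoid.

Definition double_coset (D : groupType) (A : set D) (z : D) (B : set D) : set D :=
  [set a * z * b | a in A & b in B].

(* [phi] is a total function on [D], but only its restriction to [dH] is *)
(* constrained (and used): that restriction is a group isomorphism [dH -> dV]. *)
Record datum (D : groupType) (P : Type) (O : P) := Datum {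
  dV : set D;
  dH : set D;
  gamma : P -> D;
  phi : D -> D;
  dV_group : group_closed (mem dV);
  dH_group : group_closed (mem dH);
  gammaO : gamma O = 1;
  cover_cosets : \bigcup_(p in [set: P]) double_coset dV (gamma p) dH = [set: D];
  disjoint_cosets : trivIset [set: P] (fun p => double_coset dV (gamma p) dH);
  dVH_conj : forall z : D, dV `&` [set z * x * z^-1 | x in dH] = [set 1];
  phi_bij : set_bij dH dV phi;
  phiM : {in dH &, {morph phi : x y / x * y}}
}.

Section Decomposition.
Variables (D : groupType) (P : Type) (O : P) (d : datum D O).
Local Notation V := (dV d).
Local Notation H := (dH d).
Local Notation γ := (gamma d).

Lemma dV1 : V 1. Proof. by case: (dV_group d) => + _; rewrite inE. Qed.
Lemma dH1 : H 1. Proof. by case: (dH_group d) => + _; rewrite inE. Qed.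
Lemma dVM x y : V x -> V y -> V (x * y).
Proof. by have := group_closedM (dV_group d); move=> /(_ x y); rewrite !inE. Qed.
Lemma dHM x y : H x -> H y -> H (x * y).
Proof. by have := group_closedM (dH_group d); move=> /(_ x y); rewrite !inE. Qed.
Lemma dVV x : V x -> V x^-1.
Proof. by have := group_closedV (dV_group d); move=> /(_ x); rewrite !inE. Qed.
Lemma dHV x : H x -> H x^-1.
Proof. by have := group_closedV (dH_group d); move=> /(_ x); rewrite !inE. Qed.

Lemma decomp_exists (z : D) :
  exists t : D * P * D, [/\ V t.1.1, H t.2 & z = t.1.1 * γ t.1.2 * t.2].
Proof.
have : [set: D] z by [].
by rewrite -(cover_cosets d) => -[p _ [g Vg [x Hx <-]]]; exists (g, p, x).
Qed.

Lemma decomp_uniq (g g' x x' : D) (p p' : P) :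
  V g -> V g' -> H x -> H x' -> g * γ p * x = g' * γ p' * x' ->
  [/\ g = g', p = p' & x = x'].
Proof.
move=> Vg Vg' Hx Hx' E.
have pp' : p = p'.
  apply: (@disjoint_cosets D P O d) => //; exists (g * γ p * x); split.
    by exists g => //; exists x.
  by rewrite E; exists g' => //; exists x'.
subst p'.
have E2 : g'^-1 * g = γ p * (x' * x^-1) * (γ p)^-1.
  have -> : g = g' * γ p * x' * x^-1 * (γ p)^-1 by rewrite -E !mulgK.
  by rewrite !mulgA mulVg mul1g.
have : (V `&` [set γ p * y * (γ p)^-1 | y in H]) (g'^-1 * g).
  split; first exact/dVM/Vg/dVV.
  by exists (x' * x^-1) => //; exact/dHM/dHV.
rewrite dVH_conj => /= gg'.
have {}gg' : g = g' by rewrite -[RHS]mulg1 -gg' mulVKg.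
by split => //; move: E; rewrite gg' => /mulgI.
Qed.

Definition decomp (z : D) : D * P * D := projT1 (cid (decomp_exists z)).
Definition leftV (z : D) : D := (decomp z).1.1.
Definition midP (z : D) : P := (decomp z).1.2.
Definition rightH (z : D) : D := (decomp z).2.

Lemma decompP z :
  [/\ V (leftV z), H (rightH z) & z = leftV z * γ (midP z) * rightH z].
Proof. exact: (projT2 (cid (decomp_exists z))). Qed.

(* These are meant for [x] in [dH], [g] in [dV]; the decomposition makes sense *)
(* on all of [D]. *)
Definition tri_r (x g : D) : D := leftV (x * g).
Definition tri_l (x g : D) : D := rightH (x * g).
Definition lambdaV (p : P) (g : D) (q : P) : D := leftV (γ p * g * γ q).
Definition rhoV (p : P) (g : D) (q : P) : D := rightH (γ p * g * γ q).
Definition lambdaH (p : P) (x : D) (q : P) : D := leftV (γ p * x * γ q).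
Definition rhoH (p : P) (x : D) (q : P) : D := rightH (γ p * x * γ q).

End Decomposition.

(* The choices made when passing from a datum to groupoids: a connected *)
(* groupoid whose vertex group at [O] is [D] (via [vertex]) and the arrows *)
(* $\tau_P$. *)
Record realization (D : groupType) (P : Type) (O : P) := Realization {
  gpd : groupoid P;
  gpd_connected : connected gpd;
  vertex : D -> gpd;
  vertex_src : forall z, src (vertex z) = O;
  vertex_tgt : forall z, tgt (vertex z) = O;
  vertex_inj : injective vertex;
  vertex_surj : forall a : gpd, src a = O -> tgt a = O -> exists z, vertex z = a;
  vertexM : forall z w e, vertex (z * w) = gcomp (vertex z) (vertex w) e;
  tau : P -> gpd;
  tau_src : forall p, src (tau p) = O;
  tau_tgt : forall p, tgt (tau p) = p;
  tauO : tau O = idt gpd O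
}.

Section FromDatumToGroupoids.
Variables (D : groupType) (P : Type) (O : P) (d : datum D O).
Variable r : realization D O.
Local Notation V := (dV d).
Local Notation H := (dH d).
Local Notation γ := (gamma d).
Local Notation φ := (phi d).
Local Notation G := (gpd r).
Local Notation ι := (vertex r).
Local Notation τ := (tau r).

Lemma mk_proof1 p z : tgt (ginv (τ p)) = src (ι z).
Proof. by rewrite tgt_inv tau_src vertex_src. Qed.
Lemma mk_proof2 p q z : tgt (gcomp (ginv (τ p)) (ι z) (mk_proof1 p z)) = src (τ q).
Proof. by rewrite tgt_comp vertex_tgt tau_src. Qed.

(* $\tau_p^{-1} z \tau_q$ *)
Definition mk (p q : P) (z : D) : G :=
  gcomp (gcomp (ginv (τ p)) (ι z) (mk_proof1 p z)) (τ q) (mk_proof2 p q z).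

Lemma src_mk p q z : src (mk p q z) = p.
Proof. by rewrite !src_comp src_inv tau_tgt. Qed.

Lemma tgt_mk p q z : tgt (mk p q z) = q.
Proof. by rewrite !tgt_comp tau_tgt. Qed.

Lemma mkE p q z : mk p q z = tcomp (ginv (τ p)) (tcomp (ι z) (τ q)).
Proof.
by rewrite /mk !tcompE tcompA // ?tgt_inv ?tau_src ?vertex_src ?vertex_tgt.
Qed.

Lemma vertexTM z w : ι (z * w) = tcomp (ι z) (ι w).
Proof.
have e : tgt (ι z) = src (ι w) by rewrite vertex_src vertex_tgt.
by rewrite -(tcompE e) -vertexM.
Qed.

Lemma vertex1 : ι 1 = idt G O.
Proof.
have e : tgt (ι 1) = src (ι 1) by rewrite vertex_src vertex_tgt.
by rewrite -[LHS](tcompK e) -vertexTM mulg1 tcomp_invl vertex_tgt.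
Qed.

Lemma mkM p q s z w : tcomp (mk p q z) (mk q s w) = mk p s (z * w).
Proof.
have E1 u : src (tcomp (ι z) u) = O by rewrite src_tcomp vertex_src.
have E2 u : src (tcomp (ι w) u) = O by rewrite src_tcomp vertex_src.
rewrite !mkE tcompA ?tgt_inv ?tau_src ?E1 //; last first.
  by rewrite tgt_tcomp ?vertex_tgt ?tau_src // src_tcomp src_inv.
rewrite tcompA ?vertex_tgt ?tau_src ?src_tcomp ?src_inv //.
rewrite tcompKV ?E2 ?tau_src // vertexTM.
by rewrite (@tcompA _ _ (ι z)) ?vertex_tgt ?vertex_src ?tau_src.
Qed.

Lemma mk1 p : mk p p 1 = idt G p.
Proof. by rewrite mkE vertex1 tcomp_idl ?tau_src // tcomp_invl tau_tgt. Qed.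

Lemma mkV p q z : ginv (mk p q z) = mk q p z^-1.
Proof.
symmetry; apply: inv_uniq; first by rewrite src_mk tgt_mk.
by rewrite mkM mulgV mk1 src_mk.
Qed.

Lemma mkO z : mk O O z = ι z.
Proof.
rewrite mkE tauO (tcomp_idr (g := ι z)) ?vertex_tgt //.
have e : tgt (idt G O) = src (ι z) by rewrite tgt_idt vertex_src.
by rewrite -{2}(tcompK e) (tcomp_idl (p := O)) ?vertex_src.
Qed.

Lemma mk_inj p q p' q' z z' : mk p q z = mk p' q' z' -> [/\ p = p', q = q' & z = z'].
Proof.
move=> E; have pp' : p = p' by rewrite -(src_mk p q z) E src_mk.
have qq' : q = q' by rewrite -(tgt_mk p q z) E tgt_mk.
subst p' q'; split=> //; apply: (@vertex_inj _ _ _ r).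
move: (congr1 (fun a => tcomp (tcomp (mk O p 1) a) (mk q O 1)) E).
by rewrite !mkM !mulg1 !mul1g !mkO.
Qed.

Lemma mk_surj (a : G) : exists z, a = mk (src a) (tgt a) z.
Proof.
set p := src a; set q := tgt a.
have s1 : tgt (τ p) = src a by rewrite tau_tgt.
have s2 : tgt a = src (ginv (τ q)) by rewrite src_inv tau_tgt.
have s3 : tgt (tcomp (τ p) a) = src (ginv (τ q)) by rewrite tgt_tcomp.
have [||z zE] := @vertex_surj _ _ _ r (tcomp (tcomp (τ p) a) (ginv (τ q))).
- by rewrite !src_tcomp tau_src.
- by rewrite tgt_tcomp // tgt_inv tau_src.
exists z; rewrite mkE zE.
rewrite (@tcompA _ _ _ _ (τ q)) ?tgt_inv // tcomp_invl tau_tgt.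
by rewrite tcomp_idr ?tgt_tcomp // tcompK.
Qed.

(* $\mathcal V(p,q)=\tau_p^{-1}V\tau_q$ and *)
(* $\mathcal H(p,q)=\tau_p^{-1}\gamma_pH\gamma_q^{-1}\tau_q$ *)
Definition calV_set : set G :=
  [set a | exists p q g, V g /\ a = mk p q g].
Definition calH_set : set G :=
  [set a | exists p q x, H x /\ a = mk p q (γ p * x * (γ q)^-1)].

Lemma calV_wide : wide_subgroupoid calV_set.
Proof.
split.
- by move=> p; exists p, p, 1; rewrite mk1; split=> //; exact: dV1.
- move=> a b e [p [q [g [Vg aE]]]] [q' [s [h [Vh bE]]]]; subst a b.
  have qq' : q = q' by move: (e); rewrite tgt_mk src_mk.
  subst q'.
  by exists p, s, (g * h); rewrite tcompE mkM; split=> //; exact: dVM.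
- move=> _ [p [q [g [Vg ->]]]]; exists q, p, g^-1.
  by rewrite mkV; split=> //; exact: dVV.
Qed.

Lemma calH_wide : wide_subgroupoid calH_set.
Proof.
split.
- move=> p; exists p, p, 1; rewrite mulg1 mulgV mk1.
  by split=> //; exact: dH1.
- move=> a b e [p [q [x [Hx aE]]]] [q' [s [y [Hy bE]]]]; subst a b.
  have qq' : q = q' by move: (e); rewrite tgt_mk src_mk.
  subst q'.
  exists p, s, (x * y); rewrite tcompE mkM; split; first exact: dHM.
  by rewrite !mulgA mulgVK.
- move=> _ [p [q [x [Hx ->]]]]; exists q, p, x^-1.
  rewrite mkV; split; first exact: dHV.
  by rewrite !invgM invgK mulgA.
Qed.

Definition calV : groupoid P := subgroupoid calV_wide.
Definition calH : groupoid P := subgroupoid calH_wide.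

Lemma calVP (a : calV) : calV_set (sval a). Proof. by case: a. Qed.
Lemma calHP (a : calH) : calH_set (sval a). Proof. by case: a. Qed.

Lemma arr_factor (a : G) :
  exists t : calV * calH, exists e, a = gcomp (sval t.1) (sval t.2) e.
Proof.
have [z ->] := mk_surj a; set p := src a; set q := tgt a.
have [Vg Hx E] := decompP d (z * γ q).
set g := leftV d _ in Vg E; set x := rightH d _ in Hx E; set s := midP d _ in E.
have gV : calV_set (mk p s g) by exists p, s, g.
have xH : calH_set (mk s q (γ s * x * (γ q)^-1)) by exists s, q, x.
exists (exist _ _ gV, exist _ _ xH) => /=.
have e : tgt (mk p s g) = src (mk s q (γ s * x * (γ q)^-1)) by rewrite src_mk tgt_mk.
by exists e; rewrite tcompE mkM !mulgA -E mulgK.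
Qed.

Lemma arr_factor_uniq (g g' : calV) (x x' : calH) e e' :
  gcomp (sval g) (sval x) e = gcomp (sval g') (sval x') e' -> g = g' /\ x = x'.
Proof.
have [p [s [v [Vv gE]]]] := calVP g; have [s1 [q [y [Hy xE]]]] := calHP x.
have [p' [s' [v' [Vv' gE']]]] := calVP g'.
have [s1' [q' [y' [Hy' xE']]]] := calHP x'.
have es : s = s1 by move: (e); rewrite gE xE src_mk tgt_mk.
have es' : s' = s1' by move: (e'); rewrite gE' xE' src_mk tgt_mk.
subst s1 s1'; rewrite !tcompE gE xE gE' xE' !mkM => /mk_inj[? ? E]; subst p' q'.
have [|? ? ?] := @decomp_uniq _ _ _ d v v' y y' s s' Vv Vv' Hy Hy'.
  by move: E; rewrite !mulgA => /mulIg.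
by subst; split; apply: sub_eq; [rewrite gE gE'|rewrite xE xE'].
Qed.

Definition factor (a : G) : calV * calH := projT1 (cid (arr_factor a)).

Lemma factorP a : exists e, a = gcomp (sval (factor a).1) (sval (factor a).2) e.
Proof. exact: (projT2 (cid (arr_factor a))). Qed.

(* The matched pair $(\mathcal V,\mathcal H)$ given by *)
(* $xg=(x\rightharpoonup g)(x\leftharpoonup g)$ in the ambient groupoid. *)
Definition harpoon_r (x : calH) (g : calV) (e : tgt x = src g) : calV :=
  (factor (gcomp (sval x) (sval g) e)).1.
Definition harpoon_l (x : calH) (g : calV) (e : tgt x = src g) : calH :=
  (factor (gcomp (sval x) (sval g) e)).2.

Lemma calH_coord (a : calH) :
  exists x, H x /\ sval a = mk (src a) (tgt a) (γ (src a) * x * (γ (tgt a))^-1).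
Proof.
have [p [q [x [Hx aE]]]] := calHP a; exists x; split=> //.
by rewrite /= aE src_mk tgt_mk.
Qed.

Definition coordH (a : calH) : D := projT1 (cid (calH_coord a)).

Lemma coordH_in a : H (coordH a).
Proof. by case: (projT2 (cid (calH_coord a))). Qed.

Lemma coordHE (a : calH) :
  sval a = mk (src a) (tgt a) (γ (src a) * coordH a * (γ (tgt a))^-1).
Proof. by case: (projT2 (cid (calH_coord a))). Qed.

Lemma phi_in x : H x -> V (φ x).
Proof. by case: (phi_bij d) => + _ _; apply. Qed.

Lemma phi_calV (a : calH) : calV_set (mk (src a) (tgt a) (φ (coordH a))).
Proof. by exists (src a), (tgt a), (φ (coordH a)); split=> //; exact/phi_in/coordH_in. Qed.

(* The induced isomorphism $\phi:\mathcal H\to\mathcal V$; see [phi_gpdE]. *)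
Definition phi_gpd (a : calH) : calV := exist _ _ (phi_calV a).

Lemma phi_gpdE (a : calH) p q x : H x ->
  sval a = mk p q (γ p * x * (γ q)^-1) -> sval (phi_gpd a) = mk p q (φ x).
Proof.
move=> Hx aE; rewrite -[LHS]/(mk (src a) (tgt a) (φ (coordH a))).
by move: (coordHE a); rewrite {1}aE => /mk_inj[<- <-] /mulIg/mulgI <-.
Qed.

Lemma src_phi_gpd a : src (phi_gpd a) = src a.
Proof. exact: src_mk. Qed.

Lemma tgt_phi_gpd a : tgt (phi_gpd a) = tgt a.
Proof. exact: tgt_mk. Qed.

Lemma phi_gpdM (a b : calH) e e' :
  phi_gpd (gcomp a b e) = gcomp (phi_gpd a) (phi_gpd b) e'.
Proof.
apply: sub_eq.
have [p [q [x [Hx aE]]]] := calHP a; have [q' [s [y [Hy bE]]]] := calHP b.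
have qq' : q = q' by move: (e); rewrite /= aE bE src_mk tgt_mk.
subst q'; rewrite [RHS]tcompE.
rewrite (phi_gpdE (p := p) (q := s) (dHM Hx Hy)); last first.
  by rewrite [LHS]tcompE aE bE mkM !mulgA mulgVK.
rewrite (phi_gpdE (p := p) (q := q) Hx) // (phi_gpdE (p := q) (q := s) Hy) //.
by rewrite mkM phiM ?inE.
Qed.

Lemma phi_gpd_bij : bijective phi_gpd.
Proof.
rewrite -setTT_bijective; split=> //.
- move=> a b _ _ ab; apply: sub_eq.
  rewrite (coordHE a) (coordHE b).
  have : sval (phi_gpd a) = sval (phi_gpd b) by rewrite ab.
  move=> /mk_inj[-> -> E]; suff -> : coordH a = coordH b by [].
  by case: (phi_bij d) => _ + _; apply=> //; rewrite inE; exact: coordH_in.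
- move=> v _; have [p [q [g [Vg vE]]]] := calVP v.
  case: (phi_bij d) => _ _ /(_ g Vg)[x Hx xg].
  have aH : calH_set (mk p q (γ p * x * (γ q)^-1)) by exists p, q, x.
  exists (exist _ _ aH) => //; apply: sub_eq.
  by rewrite vE (phi_gpdE (p := p) (q := q) Hx) ?xg.
Qed.

Lemma phi_gpd_surj (g : calV) : exists a, phi_gpd a = g.
Proof. by case: phi_gpd_bij => f _ fK; exists (f g). Qed.

Definition phi_gpd_inv (g : calV) : calH := projT1 (cid (phi_gpd_surj g)).

Lemma phi_gpd_invK g : phi_gpd (phi_gpd_inv g) = g.
Proof. exact: (projT2 (cid (phi_gpd_surj g))). Qed.

Lemma tgt_phi_gpd_inv g : tgt (phi_gpd_inv g) = tgt g.
Proof. by rewrite -tgt_phi_gpd phi_gpd_invK. Qed.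

Definition braid_r (g h : calV) (e : tgt g = src h) : calV :=
  harpoon_r (etrans (tgt_phi_gpd_inv g) e).
Definition braid_l (g h : calV) (e : tgt g = src h) : calV :=
  phi_gpd (harpoon_l (etrans (tgt_phi_gpd_inv g) e)).

Definition braided_groupoid_datum : Prop := braided_groupoid braid_r braid_l.

End FromDatumToGroupoids.

(* A realization always exists: the arrows from [p] to [q] are the [(p, z, q)] *)
(* with [z] in [D]. *)
Section StandardRealization.
Variables (D : groupType) (P : Type) (O : P).

Definition std_groupoid : groupoid P.
Proof.
refine (@Groupoid P (P * D * P) (fun a => a.1.1) (fun a => a.2)
  (fun a b _ => (a.1.1, a.1.2 * b.1.2, b.2)) (fun p => (p, 1, p))
  (fun a => (a.2, a.1.2^-1, a.1.1)) _ _ _ _ _ _ _ _ _ _ _) => //=.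
- by move=> [[p z] q] [[p' z'] q'] [[p'' z''] q''] /=; rewrite mulgA.
- by move=> [[p z] q] /=; rewrite mul1g.
- by move=> [[p z] q] /=; rewrite mulg1.
- by move=> [[p z] q] /=; rewrite mulVg.
- by move=> [[p z] q] /=; rewrite mulgV.
Defined.

Definition std_realization : realization D O.
Proof.
refine (@Realization D P O std_groupoid _ (fun z => (O, z, O)) _ _ _ _ _
  (fun p => (O, 1, p)) _ _ _) => //=.
- by move=> p q; exists (p, 1, q).
- by move=> z w [].
- by move=> [[p z] q] /= -> ->; exists z.
Defined.

End StandardRealization.

(* Main.v *)
(** Let [M (g * gamma_P * x) = g * phi x] be the map [D -> V] induced by the
    double coset decomposition.  The matched pair axioms always hold, by
    uniqueness of factorisations in the ambient groupoid; in the coordinates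
    given by [tau], the braiding identity says that
    [M (gamma_P * x * gamma_Q^-1 * g * gamma_S) = phi x * g] for all [P], [Q],
    [S], [x] and [g].  Putting some of the variables equal to the base point or
    to [1] gives the three conditions.  Conversely, these conditions say that [M]
    turns right multiplication by an element of [H], by some [gamma_P] and by an
    element of [V] into right multiplication by its image under [phi], by [1] and
    by itself, respectively. *)
Require Import Defs.
From mathcomp Require Import all_boot.
From mathcomp Require Import boolp classical_sets functions.

Set Implicit Arguments.
Unset Strict Implicit.
Unset Printing Implicit Defensive.

Local Open Scope group_scope.

(** * The map [M], here [mul_phi], and the three conditions *)

Section MulPhi.
Variables (D : groupType) (P : Type) (O : P) (d : datum D O).
Local Notation V := (dV d).
Local Notation H := (dH d).
Local Notation γ := (gamma d).
Local Notation φ := (phi d).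

Definition mul_phi (w : D) : D := leftV d w * φ (rightH d w).

Lemma phi1 : φ 1 = 1.
Proof.
have H1 := dH1 d.
by apply: (@mulgI _ (φ 1)); rewrite -phiM ?inE // !mulg1.
Qed.

Lemma mul_phiE g p x : V g -> H x -> mul_phi (g * γ p * x) = g * φ x.
Proof.
move=> Vg Hx; have [Vl Hr wE] := decompP d (g * γ p * x).
by have [gE _ xE] := decomp_uniq Vg Vl Hx Hr wE; rewrite /mul_phi -gE -xE.
Qed.

Lemma mul_phi_gamma p : mul_phi (γ p) = 1.
Proof.
have := @mul_phiE 1 p 1 (dV1 d) (dH1 d).
by rewrite !mulg1 mul1g phi1 mulg1.
Qed.

Lemma mul_phiMH w x : H x -> mul_phi (w * x) = mul_phi w * φ x.
Proof.
move=> Hx; have [Vl Hr wE] := decompP d w.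
rewrite {1}wE -(mulgA (_ * _)) mul_phiE //; last exact: dHM.
by rewrite phiM ?inE // mulgA.
Qed.

Lemma mul_phiVM g w : V g -> mul_phi (g * w) = g * mul_phi w.
Proof.
move=> Vg; have [Vl Hr wE] := decompP d w.
rewrite {1}wE 2!mulgA mul_phiE //; last exact: dVM.
by rewrite -mulgA.
Qed.

(** The braiding identity for the arrows [mk r p q (φ x)] and [mk r q s g], read inside the
    group. *)
Definition mul_phi_braided : Prop :=
  forall p q s g x, V g -> H x ->
    φ x * g = mul_phi (γ p * x * (γ q)^-1 * g * γ s).

Lemma mul_phi_braidedP :
  mul_phi_braided <->
  forall (p q : P) (g x : D), V g -> H x ->
    [/\ g = lambdaV d p g q * φ (rhoV d p g q),
        φ x = lambdaH d p x q * φ (rhoH d p x q) &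
        φ x * g = tri_r d x g * φ (tri_l d x g)].
Proof.
split=> [B p q g x Vg Hx | C].
  split.
  - have := B p O q g 1 Vg (dH1 d).
    by rewrite phi1 mul1g gammaO invg1 !mulg1.
  - have := B p O q 1 x (dV1 d) Hx.
    by rewrite gammaO invg1 !mulg1.
  - have := B O O O g x Vg Hx.
    by rewrite gammaO invg1 !mulg1 mul1g.
have V1 := dV1 d; have H1 := dH1 d.
have CV p q g : V g -> mul_phi (γ p * g * γ q) = g.
  by move=> Vg; have [/esym] := C p q g 1 Vg H1.
have CH p q x : H x -> mul_phi (γ p * x * γ q) = φ x.
  by move=> Hx; have [_ /esym] := C p q 1 x V1 Hx.
have CVH x g : V g -> H x -> mul_phi (x * g) = φ x * g.
  by move=> Vg Hx; have [_ _ /esym] := C O O g x Vg Hx.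
(* The left factor of [w] comes out in front; the second condition evaluates what remains. *)
have Mγ w s : mul_phi (w * γ s) = mul_phi w.
  have [Vl Hr wE] := decompP d w.
  by rewrite {1}wE -2!mulgA mul_phiVM // mulgA CH.
(* Write [w = l γ_m r] and [r g = l' γ_n r']. The first condition gives
   [M(γ_m l' γ_n r') = l' φ(r') = M(r g)], and the third says that this is [φ(r) g]. *)
have MV w g : V g -> mul_phi (w * g) = mul_phi w * g.
  move=> Vg; have [Vl Hr wE] := decompP d w.
  rewrite {1}wE -2!mulgA mul_phiVM // /mul_phi -(mulgA (leftV d w)); congr (_ * _).
  rewrite -/(mul_phi _) -CVH //.
  have [Vl' Hr' E] := decompP d (rightH d w * g).
  by rewrite {1}E 2!mulgA (mul_phiMH _ Hr') CV.
(* Using [Mγ] backwards inserts [γ q], which cancels [(γ q)^-1]. *)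
move=> p q s g x Vg Hx; rewrite Mγ MV // -(Mγ _ q) mulgVK mul_phiMH //.
by rewrite mul_phi_gamma mul1g.
Qed.

End MulPhi.

(** * The braiding in the ambient groupoid and in coordinates *)

Section Braiding.
Variables (D : groupType) (P : Type) (O : P) (d : datum D O).
Variable r : realization D O.
Local Notation V := (dV d).
Local Notation H := (dH d).
Local Notation γ := (gamma d).
Local Notation φ := (phi d).
Local Notation G := (gpd r).
Local Notation 𝒱 := (calV d r).
Local Notation ψ := (@phi_gpd_inv D P O d r).

Lemma calV_compE (f g : 𝒱) e : sval (gcomp f g e) = tcomp (sval f) (sval g).
Proof. exact: tcompE. Qed.

Lemma phi_gpd_inj : injective (@phi_gpd D P O d r).
Proof. exact/bij_inj/phi_gpd_bij. Qed.

Lemma phi_gpdK a : ψ (phi_gpd a) = a.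
Proof. by apply: phi_gpd_inj; rewrite phi_gpd_invK. Qed.

Lemma src_phi_gpd_inv (g : 𝒱) : src (ψ g) = src g.
Proof. by rewrite -src_phi_gpd phi_gpd_invK. Qed.

Lemma phi_gpd_inv_val (a : 𝒱) p q x : H x -> sval a = mk r p q (φ x) ->
  sval (ψ a) = mk r p q (γ p * x * (γ q)^-1).
Proof.
move=> Hx aE.
have bH : calH_set d (mk r p q (γ p * x * (γ q)^-1)) by exists p, q, x.
pose b : calH d r := exist _ _ bH; suff -> : a = phi_gpd b by rewrite phi_gpdK.
by apply: sub_eq; rewrite aE (phi_gpdE (a := b) Hx (erefl _)).
Qed.

(* With both [hval] and [sval] landing in the ambient groupoid, [braid_r] and *)
(* [braid_l] are determined by [hval f * sval g = sval (f ⇀ g) * hval (f ↼ g)]. *)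
Definition hval (f : 𝒱) : G := sval (ψ f).

Lemma src_hval f : src (hval f) = src f. Proof. exact: src_phi_gpd_inv. Qed.
Lemma tgt_hval f : tgt (hval f) = tgt f. Proof. exact: tgt_phi_gpd_inv. Qed.

Lemma hvalM (f g : 𝒱) e : hval (gcomp f g e) = tcomp (hval f) (hval g).
Proof.
have e' : tgt (ψ f) = src (ψ g) by rewrite tgt_phi_gpd_inv src_phi_gpd_inv.
have e2 : tgt (phi_gpd (ψ f)) = src (phi_gpd (ψ g)).
  by rewrite tgt_phi_gpd src_phi_gpd.
have fgE : phi_gpd (gcomp (ψ f) (ψ g) e') = gcomp f g e.
  rewrite (phi_gpdM e' e2); move: e2; rewrite !phi_gpd_invK => e2.
  exact: comp_irr.
by rewrite /hval -fgE phi_gpdK; exact: tcompE.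
Qed.

Lemma hval1 p : hval (idt 𝒱 p) = idt G p.
Proof.
rewrite /hval (phi_gpd_inv_val (p := p) (q := p) (dH1 d)) ?phi1 ?mk1 //.
by rewrite mulg1 mulgV mk1.
Qed.

Lemma braidE (f g : 𝒱) e :
  tgt (braid_r e) = src (@braid_l _ _ _ _ _ f g e) /\
  tcomp (hval f) (sval g) = tcomp (sval (braid_r e)) (hval (braid_l e)).
Proof.
have [e1 E] := factorP d (gcomp (sval (ψ f)) (sval g) (etrans (tgt_phi_gpd_inv f) e)).
split; first by rewrite src_phi_gpd; exact: e1.
rewrite /hval phi_gpdK.
exact: etrans (esym (tcompE _)) (etrans E (tcompE _)).
Qed.

(** Uniqueness of factorisations reduces each matched pair axiom to one equation between products in
    the ambient groupoid. *)
Lemma braid_uniq (f g v y : 𝒱) e : tgt v = src y ->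
  tcomp (hval f) (sval g) = tcomp (sval v) (hval y) ->
  braid_r e = v /\ @braid_l _ _ _ _ _ f g e = y.
Proof.
have [e1 ->] := braidE e.
have e1' : tgt (sval (braid_r e)) = src (hval (braid_l e)) by rewrite src_hval.
move=> e2; have e2' : tgt (sval v) = src (hval y) by rewrite src_hval.
rewrite -(tcompE e1') -(tcompE e2') => /(@arr_factor_uniq D P O d r)[-> E].
split=> //; by rewrite -[LHS]phi_gpd_invK E phi_gpd_invK.
Qed.

Lemma src_braid_r (f g : 𝒱) e : src (@braid_r _ _ _ _ _ f g e) = src f.
Proof.
have [e1 E] := braidE e; have := congr1 src E.
by rewrite !src_tcomp src_hval => ->.
Qed.

Lemma tgt_braid_l (f g : 𝒱) e : tgt (@braid_l _ _ _ _ _ f g e) = tgt g.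
Proof.
have [e1 E] := braidE e; have := congr1 tgt E.
by rewrite !tgt_tcomp ?tgt_hval ?src_hval.
Qed.

(** Moving [x] leftwards past [h], then past [f], factorises the product of all three. This yields
    at once the action law of [⇀] and the product rule of [↼]. *)
Lemma braid_compl (f h x : 𝒱) efh ehx e1 e2 e3 :
  braid_r e2 = @braid_r _ _ _ _ _ f (@braid_r _ _ _ _ _ h x ehx) e1 /\
  @braid_l _ _ _ _ _ (gcomp f h efh) x e2 =
    gcomp (@braid_l _ _ _ _ _ f (@braid_r _ _ _ _ _ h x ehx) e1)
          (@braid_l _ _ _ _ _ h x ehx) e3.
Proof.
have [t1 E1] := braidE ehx; have [t2 E2] := braidE e1.
apply: braid_uniq; first by rewrite src_comp.
rewrite !hvalM tcompA ?tgt_hval ?src_hval // E1.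
rewrite -tcompA ?tgt_hval ?src_hval // E2.
by rewrite tcompA ?tgt_hval ?src_hval.
Qed.

(** The mirror image: [x] moves rightwards past [g], then past [h]. *)
Lemma braid_compr (x g h : 𝒱) exg egh e1 e2 e3 :
  @braid_r _ _ _ _ _ x (gcomp g h egh) e2 =
    gcomp (@braid_r _ _ _ _ _ x g exg)
          (@braid_r _ _ _ _ _ (@braid_l _ _ _ _ _ x g exg) h e1) e3 /\
  braid_l e2 = @braid_l _ _ _ _ _ (@braid_l _ _ _ _ _ x g exg) h e1.
Proof.
have [t1 E1] := braidE exg; have [t2 E2] := braidE e1.
apply: braid_uniq; first by rewrite tgt_comp.
rewrite !calV_compE -tcompA ?tgt_hval ?src_hval // E1.
rewrite tcompA ?tgt_hval ?src_hval // E2.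
by rewrite tcompA ?tgt_hval ?src_hval // src_tcomp.
Qed.

Lemma braid_matched_pair : matched_pair (@braid_r D P O d r) (@braid_l D P O d r).
Proof.
split; last split.
- split; first exact: src_braid_r.
  + move=> f h x efh ehx e1 e2.
    have e3 : tgt (braid_l e1) = src (braid_l ehx).
      by rewrite tgt_braid_l; case: (braidE ehx).
    by case: (braid_compl e2 e3).
  (* The factorisation behind the unit law is [id x = x id]. *)
  + move=> x e; have [] // := @braid_uniq _ x x (idt 𝒱 (tgt x)) e.
      by rewrite src_idt.
    by rewrite !hval1 tcomp_idl // tcomp_idr.
- split; first exact: tgt_braid_l.
  + move=> x g h exg egh e1 e2.
    have e3 : tgt (braid_r exg) = src (braid_r e1).
      by rewrite src_braid_r; case: (braidE exg).
    by case: (braid_compr e2 e3).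
  + move=> x e; have [] // := @braid_uniq x _ (idt 𝒱 (src x)) x e.
      by rewrite tgt_idt.
    by rewrite tcomp_idl ?src_hval // tcomp_idr // tgt_hval.
- split.
  + by move=> x g e; case: (braidE e).
  + by move=> x g h e egh e1 e2 e3; case: (braid_compr e1 e3).
  + by move=> x y g exy e e1 e2 e3; case: (braid_compl e1 e3).
Qed.

(** The last factor [γ s] of [w] compensates for the [(γ s)^-1] ending the coordinate of an arrow of
    [calH] with target [s]. *)
Lemma braid_coord (f g : 𝒱) e p q s x h : H x ->
  sval f = mk r p q (φ x) -> sval g = mk r q s h ->
  let w := γ p * x * (γ q)^-1 * h * γ s in
  sval (@braid_r _ _ _ _ _ f g e) = mk r p (midP d w) (leftV d w) /\
  sval (@braid_l _ _ _ _ _ f g e) = mk r (midP d w) s (φ (rightH d w)).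
Proof.
move=> Hx fE gE w; have [Vl Hr wE] := decompP d w.
have vV : calV_set d (mk r p (midP d w) (leftV d w)).
  by exists p, (midP d w), (leftV d w).
have yV : calV_set d (mk r (midP d w) s (φ (rightH d w))).
  by exists (midP d w), s, (φ (rightH d w)); split=> //; exact: phi_in.
pose v : 𝒱 := exist _ _ vV; pose y : 𝒱 := exist _ _ yV.
have [] := @braid_uniq f g v y e; last by move=> -> ->.
  by rewrite /= tgt_mk src_mk.
rewrite /hval (phi_gpd_inv_val Hx fE) (phi_gpd_inv_val (a := y) Hr (erefl _)).
by rewrite gE !mkM !mulgA -wE /w mulgK.
Qed.

(** In the notation of [braid_coord], the two sides of the braiding identity are
    [mk r p s (φ x * h)] and [mk r p s (mul_phi d w)]. *)
Lemma braided_groupoid_datumP : braided_groupoid_datum d r <-> mul_phi_braided d.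
Proof.
split=> [[_ B] p q s g x Vg Hx | B].
  have fV : calV_set d (mk r p q (φ x)).
    by exists p, q, (φ x); split=> //; exact: phi_in.
  have gV : calV_set d (mk r q s g) by exists q, s, g.
  pose f : 𝒱 := exist _ _ fV; pose h : 𝒱 := exist _ _ gV.
  have e : tgt f = src h by rewrite /= tgt_mk src_mk.
  have [e' _] := braidE e.
  have := congr1 sval (B f h e e'); rewrite !calV_compE.
  have [-> ->] := braid_coord e Hx (erefl _) (erefl _).
  by rewrite !mkM => /(@mk_inj D P O r)[].
split=> [|f g e e']; first exact: braid_matched_pair.
have [p [q [v [Vv fE]]]] := calVP f; have [q' [s [h [Vh gE]]]] := calVP g.
have qq' : q = q' by move: (e); rewrite /= fE gE src_mk tgt_mk.
subst q'; case: (phi_bij d) => _ _ /(_ v Vv)[x Hx xv]; subst v.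
apply: sub_eq; rewrite !calV_compE.
have [-> ->] := braid_coord e Hx fE gE.
by rewrite fE gE !mkM (B p q s).
Qed.

End Braiding.

Theorem theorem1p11 (D : groupType) (P : Type) (O : P) (d : datum D O)
    (r : realization D O) :
  braided_groupoid_datum d r <->
  forall (p q : P) (g x : D), dV d g -> dH d x ->
    [/\ g = lambdaV d p g q * phi d (rhoV d p g q),
        phi d x = lambdaH d p x q * phi d (rhoH d p x q) &
        phi d x * g = tri_r d x g * phi d (tri_l d x g)].
Proof. by rewrite braided_groupoid_datumP mul_phi_braidedP. Qed.
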